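(* Suppose that $\{e_i\}$ is a normalized suppression unconditional basic sequence, invariant under spreading, with Rosenthal's property. If $1$ belongs to the Krivine set of $\{e_i\}$, then $\{e_i\}$ is equivalent to the unit vector basis of $\ell_1$.
   Context: Scalars are real. A normalized block basis of $\{e_i\}$ is a sequence of norm-one finite linear combinations of the $e_i$ with successive supports. Two basic sequences $\{x_i\},\{y_i\}$ (finite or infinite) are $C$-equivalent if $C^{-1}\|\sum a_i x_i\|\le\|\sum a_i y_i\|\le C\|\sum a_i x_i\|$ for all finitely supported scalars $(a_i)$; equivalent means $C$-equivalent for some $C$. A normalized basic sequence $\{e_i\}$ has Rosenthal's property if every normalized block basis of $\{e_i\}$ has a subsequence equivalent to $\{e_i\}$. $\{e_i\}$ is invariant under spreading if it is $1$-equivalent to each of its subsequences. $\{e_i\}$ is suppression unconditional if $\|\sum_{i\in A}a_ie_i\|\le\|\sum_i a_ie_i\|$ for all finitely supported $(a_i)$ and all sets $A$ of indices. For a suppression unconditional $\{e_i\}$ invariant under spreading, the Krivine set of $\{e_i\}$ is the set of $p\in[1,\infty]$ such that for all $k\in\mathbb N$ and $\epsilon>0$ there are identically distributed blocks $x_1<x_2<\cdots<x_k$ of $\{e_i\}$ (that is, there are scalars $r_0,\dots,r_l$ and indices $m_j$ with $m_j+l<m_{j+1}$ such that $x_j=\sum_{i=0}^l r_ie_{m_j+i}$ for $1\le j\le k$) that are $(1+\epsilon)$-equivalent to the unit vector basis of $\ell_p^k$. *)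

(* Defs.v *)
From HB Require Import structures.
From mathcomp Require Import all_boot all_order all_algebra.
From mathcomp Require Import all_classical all_reals all_analysis.
From mathcomp Require finmap.

Set Implicit Arguments.
Unset Strict Implicit.
Unset Printing Implicit Defensive.

Import Order.TTheory GRing.Theory Num.Theory.
Import numFieldNormedType.Exports.

Local Open Scope classical_set_scope.
Local Open Scope ring_scope.

(* A finitely supported family of scalars is given by [a : nat -> R] and a
   length [n], the coefficients being [a 0, ..., a (n - 1)]. *)
Definition lincomb (R : realType) (X : normedModType R) (x : nat -> X)
    (n : nat) (a : nat -> R) : X :=
  \sum_(i < n) a i *: x i.

Definition lincomb_norm (R : realType) (X : normedModType R) (x : nat -> X)
    (n : nat) (a : nat -> R) : R :=
  `|lincomb x n a|.

(* The [ell_p] norm of (a 0, ..., a (n - 1), 0, 0, ...), i.e. the norm of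
   the combination with these coefficients of the unit vector basis of
   [ell_p], or of [ell_p^n]. *)
Definition lp_norm (R : realType) (p : \bar R) (n : nat) (a : nat -> R) : R :=
  fine (Lnorm counting p (fun i : nat => (if (i < n)%N then a i else 0)%:E)).

Lemma lp_norm_fin (R : realType) (p : R) (n : nat) (a : nat -> R) : 0 < p ->
  lp_norm p%:E n a = (\sum_(i < n) `|a i| `^ p) `^ p^-1.
Proof.
move=> p0; rewrite /lp_norm Lnorm_counting//.
rewrite (nneseries_split_cond 0 n); last by move=> k _; exact: poweR_ge0.
rewrite eseries0 ?adde0; last first.
  move=> i; rewrite add0n => ni _ /=.
  by rewrite ltnNge ni/= normr0 powR0 ?gt_eqF.
rewrite add0n big_mkord.
under eq_bigr => i _ do rewrite ltn_ord /= .
by rewrite sumEFin.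
Qed.

Lemma lp_norm_pinfty (R : realType) (n : nat) (a : nat -> R) :
  lp_norm +oo%E n a = \big[Num.max/0]_(i < n) `|a i|.
Proof.
rewrite /lp_norm unlock /=.
have mu0 : (0 < @counting nat R setT)%E.
  rewrite /counting; case: ifPn => [/asboolP|_]; [by move=> /infinite_nat | exact: ltry].
rewrite mu0.
set f := abse \o _.
suff -> : ess_sup_inf.ess_sup counting f = (\big[Num.max/0]_(i < n) `|a i|)%:E by [].
apply/eqP; rewrite eq_le; apply/andP; split.
- apply/ess_sup_inf.ess_supP; apply: nearW => i; rewrite /f /= lee_fin.
  case: ifPn => [ilt|_]; last by rewrite normr0; exact: bigmax_ge_id.
  exact: (@le_bigmax _ _ _ 0 (fun j : 'I_n => `|a j|) (Ordinal ilt)).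
- have H y : (\forall x \ae (@counting nat R), (f x <= y)%E) ->
     forall x, (f x <= y)%E.
    move=> [A [mA A0 sA]] x; apply: contrapT => nx.
    have Ax : A x by exact: sA.
    have : counting [set x] = 0%E :> \bar R.
      apply/eqP; rewrite eq_le measure_ge0 andbT -A0; apply: le_measure.
      + exact: mem_set.
      + exact: mem_set.
      + by move=> _ ->.
    rewrite /counting; case: asboolP => [_|nf].
      by rewrite fset_set1 finmap.cardfs1 => /eqP; rewrite eqe oner_eq0.
    by case: nf; exact: finite_set1.
  have ge i : (f i <= ess_sup_inf.ess_sup counting f)%E.
    by apply: H; exact: ess_sup_inf.ess_sup_ge.
  have f0 : (0 <= ess_sup_inf.ess_sup counting f)%E.
    by apply: le_trans (ge 0%N); exact: abse_ge0.
  case E : (ess_sup_inf.ess_sup counting f) f0 ge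
    => [r| |] //= r0 ge; last exact: leey.
  rewrite lee_fin; apply: bigmax_le => // i _.
  by have := ge i; rewrite /f /= ltn_ord lee_fin.
Qed.

(* A sequence enters an equivalence only through the norms of its linear
   combinations: the arguments [N] and [M] below are of the form
   [lincomb_norm x] for a sequence [x] of vectors, or [lp_norm p] for the
   unit vector basis of [ell_p].  [C_equivalent_at C k N M] is the
   [C]-equivalence of the finite sequences formed by the first [k] vectors. *)
Definition C_equivalent_at (R : realType) (C : R) (k : nat)
    (N M : nat -> (nat -> R) -> R) : Prop :=
  forall a : nat -> R, C^-1 * N k a <= M k a /\ M k a <= C * N k a.

Definition C_equivalent (R : realType) (C : R)
    (N M : nat -> (nat -> R) -> R) : Prop :=
  forall n : nat, C_equivalent_at C n N M.

Definition equivalent (R : realType) (N M : nat -> (nat -> R) -> R) : Prop :=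
  exists C : R, 0 < C /\ C_equivalent C N M.

Definition lin_span (R : realType) (X : normedModType R) (e : nat -> X) :
    set X :=
  [set v | exists (n : nat) (a : nat -> R), v = lincomb e n a].

Definition basic_sequence (R : realType) (X : completeNormedModType R)
    (e : nat -> X) : Prop :=
  forall v : X, closure (lin_span e) v ->
    exists! a : nat -> R, (fun n => lincomb e n a) @ \oo --> v.

Definition normalized (R : realType) (X : normedModType R) (e : nat -> X) :
    Prop :=
  forall i : nat, `|e i| = 1.

Definition strictly_increasing (phi : nat -> nat) : Prop :=
  {homo phi : i j / (i < j)%N}.

(* The block [b j] is supported in the interval [m j, m (j + 1)). *)
Definition normalized_block_basis (R : realType) (X : normedModType R)
    (e b : nat -> X) : Prop :=
  normalized b /\
  exists (m : nat -> nat) (c : nat -> R), strictly_increasing m /\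
    forall j : nat, b j = \sum_(m j <= i < m j.+1) c i *: e i.

Definition rosenthal (R : realType) (X : normedModType R) (e : nat -> X) :
    Prop :=
  forall b : nat -> X, normalized_block_basis e b ->
    exists phi : nat -> nat, strictly_increasing phi /\
      equivalent (lincomb_norm (b \o phi)) (lincomb_norm e).

Definition spreading_invariant (R : realType) (X : normedModType R)
    (e : nat -> X) : Prop :=
  forall phi : nat -> nat, strictly_increasing phi ->
    C_equivalent 1 (lincomb_norm e) (lincomb_norm (e \o phi)).

Definition suppression_unconditional (R : realType) (X : normedModType R)
    (e : nat -> X) : Prop :=
  forall (n : nat) (a : nat -> R) (A : pred nat),
    `|\sum_(i < n | A i) a i *: e i| <= `|\sum_(i < n) a i *: e i|.

(* Only the values [x j] with [j < k] matter. *)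
Definition identically_distributed_blocks (R : realType)
    (X : normedModType R) (e : nat -> X) (k : nat) (x : nat -> X) : Prop :=
  exists (l : nat) (r : nat -> R) (m : nat -> nat),
    (forall j : nat, (j.+1 < k)%N -> (m j + l < m j.+1)%N) /\
    (forall j : nat, (j < k)%N -> x j = \sum_(i < l.+1) r i *: e (m j + i)%N).

Definition krivine_set (R : realType) (X : normedModType R) (e : nat -> X) :
    set (\bar R) :=
  [set p | (1 <= p)%E /\
    forall (k : nat) (eps : R), 0 < eps ->
      exists x : nat -> X, identically_distributed_blocks e k x /\
        C_equivalent_at (1 + eps) k (lincomb_norm x) (lp_norm p)].

(* Main.v *)
(* If [e] is not equivalent to the basis of [ell_1], then for every [n] some
   finite combination of [e] with coefficients [a_n] has norm less than [4^-n]
   times the [ell_1] norm of [a_n].  Since [1] is in the Krivine set, there is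
   a vector [u_n] as many copies of which as [a_n] has coefficients are
   2-equivalent to the [ell_1] basis, wherever the copies are placed in
   succession (by spreading invariance).  Let [z_j] be a sum over [n <= j] of
   [2^-n] times a copy of [u_n], and normalize.  Apply [a_n] to the terms from
   the [n]-th on of a subsequence equivalent to [e]: suppressing everything but
   the copies of [u_n] leaves norm at least [2^-n / 8] times the [ell_1] norm
   of [a_n].  So [2^n] is bounded, a contradiction. *)
Require Import Defs.
From mathcomp Require Import all_boot all_order all_algebra.
From mathcomp Require Import all_classical all_reals all_analysis.
From mathcomp Require Import zify ring lra.

Set Implicit Arguments.
Unset Strict Implicit.
Unset Printing Implicit Defensive.

Import Order.TTheory GRing.Theory Num.Theory.
Import numFieldNormedType.Exports.

Local Open Scope ring_scope.

Lemma lp_norm1 (R : realType) (n : nat) (a : nat -> R) :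
  lp_norm 1%E n a = \sum_(i < n) `|a i|.
Proof.
rewrite lp_norm_fin// invr1 powRr1; last by apply: sumr_ge0 => i _; exact: powR_ge0.
by apply: eq_bigr => i _; rewrite powRr1.
Qed.

(** * Increasing index sequences and sums cut along them *)

Lemma strictly_increasing_step (m : nat -> nat) :
  (forall j, (m j < m j.+1)%N) -> strictly_increasing m.
Proof. by move=> mS; apply: homo_ltn => //; exact: ltn_trans. Qed.

Lemma strictly_increasing_mono (m : nat -> nat) : strictly_increasing m ->
  {homo m : i j / (i <= j)%N}.
Proof.
by move=> mi i j; rewrite leq_eqVlt => /orP[/eqP->//|/mi/ltnW].
Qed.

Lemma strictly_increasing_ge (m : nat -> nat) (i : nat) :
  strictly_increasing m -> (i <= m i)%N.
Proof.
by move=> mi; elim: i => // i IH; apply: (leq_ltn_trans IH); exact: mi.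
Qed.

(** Turns coefficients prescribed interval by interval into one sequence; this works because the
    intervals [[m j, m j.+1)] are disjoint. *)
Lemma glue (R : realType) (m : nat -> nat) (f : nat -> nat -> R) :
  strictly_increasing m ->
  exists c : nat -> R, (forall t, (t < m 0)%N -> c t = 0) /\
    forall j i, (m j + i < m j.+1)%N -> c (m j + i)%N = f j i.
Proof.
move=> mi; pose P t j := (m j <= t < m j.+1)%N.
(* If [t] lies in the [j]-th interval then [j <= m j <= t], so the range [j < t.+1] misses no
   interval. *)
exists (fun t => \sum_(j < t.+1 | P t j) f j (t - m j)%N); split.
  move=> t t0; apply: big1 => j /andP[mjt _]; exfalso.
  by have := strictly_increasing_mono mi (leq0n j); lia.
move=> j i ji; have jlt : (j < (m j + i).+1)%N.
  by have := strictly_increasing_ge j mi; lia.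
rewrite (big_pred1 (Ordinal jlt)) /=; first by rewrite addKn.
move=> k; rewrite /P /=; apply/idP/eqP => [/andP[h1 h2]|->/=]; last by lia.
apply: val_inj => /=; apply/eqP; rewrite eqn_leq; apply/andP; split.
- by rewrite leqNgt; apply/negP => /(strictly_increasing_mono mi); lia.
- by rewrite leqNgt; apply/negP => /(strictly_increasing_mono mi); lia.
Qed.

Lemma sum_chunks (V : zmodType) (p : nat -> nat) (F : nat -> V) (K : nat) :
  strictly_increasing p ->
  \sum_(u < p K) F u = \sum_(u < p 0) F u +
    \sum_(i < K) \sum_(t < p i.+1 - p i) F (p i + t)%N.
Proof.
move=> pi; elim: K => [|K IH]; first by rewrite big_ord0 addr0.
rewrite big_ord_recr /= addrA -IH.
transitivity (\sum_(u < p K + (p K.+1 - p K)) F u).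
  by rewrite subnKC// ltnW// pi.
by rewrite big_split_ord.
Qed.

Lemma sum_trunc (V : zmodType) (F : nat -> V) (D n : nat) : (D <= n)%N ->
  \sum_(t < n) (if (t < D)%N then F t else 0) = \sum_(t < D) F t.
Proof. by move=> Dn; rewrite (big_ord_widen n F Dn) [RHS]big_mkcond. Qed.

Lemma sum_window (V : zmodType) (F : nat -> V) (s l n : nat) :
  (s + l <= n)%N ->
  \sum_(t < n) (if (s <= t < s + l)%N then F t else 0) =
  \sum_(t < l) F (s + t)%N.
Proof.
move=> sln; under eq_bigr => t _ do rewrite andbC if_and.
rewrite (sum_trunc (fun t => if (s <= t)%N then F t else 0) sln).
rewrite big_split_ord /= big1 ?add0r => [|t _]; last by rewrite leqNgt ltn_ord.
by apply: eq_bigr => t _; rewrite leq_addr.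
Qed.

(** * Suppression and spreading for combinations of blocks *)

Section Blocks.
Context (R : realType) (X : normedModType R) (e : nat -> X).

(** Glue [f] into one coefficient sequence; [g] is then its restriction to the set of indices where
    [g] is nonzero, and suppression applies. *)
Lemma suppression_chunks (p : nat -> nat) (f g : nat -> nat -> R) (K : nat) :
  suppression_unconditional e -> strictly_increasing p ->
  (forall i t, g i t = f i t \/ g i t = 0) ->
  `|\sum_(i < K) \sum_(t < p i.+1 - p i) g i t *: e (p i + t)%N| <=
  `|\sum_(i < K) \sum_(t < p i.+1 - p i) f i t *: e (p i + t)%N|.
Proof.
move=> unc pi gf.
have [a [a0 af]] := glue f pi.
have E (c : nat -> R) h : (forall t, (t < p 0)%N -> c t = 0) ->
    (forall j i, (p j + i < p j.+1)%N -> c (p j + i)%N = h j i) ->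
    \sum_(i < K) \sum_(t < p i.+1 - p i) h i t *: e (p i + t)%N =
    \sum_(u < p K) c u *: e u.
  move=> c0 ch; rewrite (sum_chunks (fun u => c u *: e u) K pi).
  rewrite [X in _ = X + _]big1 ?add0r.
    apply: eq_bigr => i _; apply: eq_bigr => t _; rewrite ch//.
    by have := ltn_ord t; lia.
  by move=> u _; rewrite c0 ?scale0r.
have gef j i : g j i != 0 -> g j i = f j i by case: (gf j i) => // ->; rewrite eqxx.
(* The support of [g], glued as a 0-1 valued sequence. *)
have [A [A0 Af]] := glue (fun j i => (g j i != 0)%:R : R) pi.
pose b u := if A u != 0 then a u else 0.
have b0 t : (t < p 0)%N -> b t = 0 by move=> t0; rewrite /b a0// if_same.
have bg j i : (p j + i < p j.+1)%N -> b (p j + i)%N = g j i.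
  move=> ij; rewrite /b Af// af// pnatr_eq0 eqb0 negbK.
  by have [->//|/gef->] := eqVneq (g j i) 0.
rewrite (E _ _ a0 af) (E _ _ b0 bg) /b.
under eq_bigr => u _ do rewrite (fun_if (fun z => z *: e u)) scale0r.
by rewrite -big_mkcond; exact: (unc (p K) a (fun u => A u != 0)).
Qed.

(** The map sending [i * L + t] to [q i + t] for [t < L] is strictly increasing, so it selects a
    subsequence of [e]. *)
Lemma spreading_chunks (q : nat -> nat) (L K : nat) (f : nat -> nat -> R) :
  spreading_invariant e -> (0 < L)%N ->
  (forall i, (i.+1 < K)%N -> (q i + L <= q i.+1)%N) ->
  `|\sum_(i < K) \sum_(t < L) f i t *: e (q i + t)%N| =
  `|\sum_(i < K) \sum_(t < L) f i t *: e (i * L + t)%N|.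
Proof.
move=> spr L0 qL; case: K => [|K] in qL *; first by rewrite !big_ord0.
(* Spreading invariance asks for a map on all of [nat], while [q] is controlled only up to [K];
   beyond, windows follow one another with step [L]. *)
pose q' i := if (i <= K)%N then q i else (q K + (i - K) * L)%N.
have q'L i : (q' i + L <= q' i.+1)%N.
  rewrite /q'; case: (ltngtP i K) => [iK|iK|->].
  - by rewrite qL.
  - by rewrite subSn ?(ltnW iK)// mulSn; lia.
  - by rewrite subSnn mul1n.
pose th u := (q' (u %/ L) + u %% L)%N.
have thi : strictly_increasing th.
  apply: strictly_increasing_step => u; rewrite /th.
  have := divn_eq u L; have := ltn_pmod u L0.
  set d := (u %/ L)%N; set r := (u %% L)%N => rL uE.
  (* Either [u.+1] stays in the window of [u] or it opens the next one. *)
  have [rL'|rL'] := ltnP r.+1 L.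
    have -> : u.+1 = (d * L + r.+1)%N by lia.
    by rewrite divnMDl// divn_small// addn0 modnMDl modn_small//; lia.
  have -> : u.+1 = (d.+1 * L)%N by rewrite mulSn; lia.
  by rewrite mulnK// modnMl; have := q'L d; lia.
pose g u := f (u %/ L)%N (u %% L)%N.
have mulLi : strictly_increasing (muln^~ L).
  by move=> i j ij; rewrite /= ltn_pmul2r.
have E (y : nat -> X) : lincomb y (K.+1 * L) g =
    \sum_(i < K.+1) \sum_(t < L) f i t *: y (i * L + t)%N.
  rewrite /lincomb (sum_chunks (fun u => g u *: y u) K.+1 mulLi) mul0n big_ord0.
  rewrite add0r; apply: eq_bigr => i _; rewrite /= mulSn addnK.
  apply: eq_bigr => t _; rewrite /g.
  by rewrite divnMDl// divn_small// addn0 modnMDl modn_small.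
have [] := spr _ thi (K.+1 * L)%N g.
rewrite invr1 !mul1r /lincomb_norm !E /= => h1 h2.
rewrite (le_anti (introT andP (conj h1 h2))); congr `|_|.
apply: eq_bigr => i _; apply: eq_bigr => t _.
rewrite /th divnMDl// divn_small// addn0 modnMDl modn_small// /q'.
by rewrite -ltnS ltn_ord.
Qed.

Lemma norm_shift (n K : nat) (a : nat -> R) : spreading_invariant e ->
  `|\sum_(i < K) a i *: e (n + i)%N| = lincomb_norm e K a.
Proof.
move=> spr; have shi : strictly_increasing (addn n).
  by move=> i j ij; rewrite ltn_add2l.
by have := spr _ shi K a; rewrite invr1 !mul1r => /andP/le_anti ->.
Qed.

(** * Copies of a vector spanning [ell_1^K], and their weighted sums *)

(** The Krivine condition with [eps = 1] gives constant 2, and by [spreading_chunks] the norm does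
    not depend on where the copies are placed. The bounds on a single copy come from the
    coefficients [1, 0, ..., 0]. *)
Lemma krivine_copies (K : nat) : spreading_invariant e ->
  krivine_set e 1%E -> (0 < K)%N ->
  exists (L : nat) (r : nat -> R), [/\ (0 < L)%N,
    forall p, 2^-1 <= `|\sum_(t < L) r t *: e (p + t)%N| <= 2 &
    forall (q : nat -> nat) (a : nat -> R),
      (forall i, (i.+1 < K)%N -> (q i + L <= q i.+1)%N) ->
      \sum_(i < K) `|a i| <=
      2 * `|\sum_(i < K) a i *: \sum_(t < L) r t *: e (q i + t)%N|].
Proof.
move=> spr [_ kriv] K0; have [x [[l [r [m [ml xE]]]] xeq]] := kriv K 1 ltr01.
have {}ml i : (i.+1 < K)%N -> (m i + l.+1 <= m i.+1)%N.
  by rewrite addnS; exact: ml.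
have copies q (a : nat -> R) : (forall i, (i.+1 < K)%N -> (q i + l.+1 <= q i.+1)%N) ->
    `|\sum_(i < K) a i *: \sum_(t < l.+1) r t *: e (q i + t)%N| =
    lincomb_norm x K a.
  move=> qL; rewrite /lincomb_norm /lincomb.
  under [in RHS]eq_bigr => i _ do rewrite xE// scaler_sumr.
  under [in LHS]eq_bigr => i _ do rewrite scaler_sumr.
  under [in LHS]eq_bigr => i _ do under eq_bigr => t _ do rewrite scalerA.
  under [in RHS]eq_bigr => i _ do under eq_bigr => t _ do rewrite scalerA.
  rewrite (spreading_chunks (fun i t => a i * r t) spr _ ml)//.
  by rewrite (spreading_chunks (fun i t => a i * r t) spr _ qL).
exists l.+1, r; split => // [p|q a qL]; last first.
  by rewrite copies//; have [_] := xeq a; rewrite lp_norm1 -[2]/(1 + 1).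
pose a i : R := (i == 0)%N%:R.
have [] := xeq a; rewrite lp_norm1.
have a1 (V : lmodType R) (F : nat -> V) : \sum_(i < K) a i *: F i = F 0.
  case: (K) K0 => // k _; rewrite big_ord_recl /= scale1r big1 ?addr0// => i _.
  by rewrite /a /= scale0r.
(* The first copy is put at [p], the others right after it. *)
rewrite -(copies (fun i => p + i * l.+1)%N) => [|i _]; last by rewrite mulSn; lia.
rewrite (a1 X (fun i => \sum_(t < l.+1) r t *: e (p + i * l.+1 + t)%N)) mul0n addn0.
have -> : \sum_(i < K) `|a i| = 1.
  by rewrite -[RHS](a1 R^o (fun=> 1)); apply: eq_bigr => i _;
    rewrite normr_nat /GRing.scale/= mulr1.
rewrite -[1 + 1]/2 ler_pdivrMl// mulr1 => h1 h2.
by rewrite h1 andbT -[2^-1]mulr1 ler_pdivrMl.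
Qed.

(* The factor 4 in [|a i| <= 4 * |a' i|] bounds the norms of the blocks before
   normalization: the [n]-th copy has norm at most [2 * 2^-n]. *)
Lemma weighted_blocks (L : nat -> nat) (r : nat -> nat -> R) :
  suppression_unconditional e -> (forall n, 0 < L n)%N ->
  (forall n p, 2^-1 <= `|\sum_(t < L n) r n t *: e (p + t)%N| <= 2) ->
  exists b, normalized_block_basis e b /\
    forall (n K : nat) (psi : nat -> nat) (a : nat -> R),
      strictly_increasing psi -> (n <= psi 0)%N ->
      exists (q : nat -> nat) (a' : nat -> R),
      [/\ forall i, (q i + L n <= q i.+1)%N,
          forall i, `|a i| <= 4 * `|a' i| &
          2^-1 ^+ n *
            `|\sum_(i < K) a' i *: \sum_(t < L n) r n t *: e (q i + t)%N| <=
          `|\sum_(i < K) a i *: b (psi i)| ].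
Proof.
move=> unc L0 rbd.
pose S n := (\sum_(k < n) L k)%N.
have SS n : S n.+1 = (S n + L n)%N by rewrite /S big_ord_recr.
have Si : strictly_increasing S.
  by apply: strictly_increasing_step => n; rewrite SS -addn1 leq_add2l.
have S0 : S 0%N = 0%N by rewrite /S big_ord0.
(* One sequence serves all blocks: [z j] uses the first [S j.+1] terms of [d], and the copy of [u_n]
   begins at offset [S n]. *)
have [d [_ dE]] := glue (fun n t => 2^-1 ^+ n * r n t) Si.
pose m j := (\sum_(k < j) S k.+1)%N.
have mS j : m j.+1 = (m j + S j.+1)%N by rewrite /m big_ord_recr.
have mi : strictly_increasing m.
  apply: strictly_increasing_step => j; rewrite mS.
  by have := Si _ _ (ltnSn j); lia.
pose z j := \sum_(t < S j.+1) d t *: e (m j + t)%N.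
have piece n K psi (a : nat -> R) : strictly_increasing psi -> (n <= psi 0)%N ->
    2^-1 ^+ n * `|\sum_(i < K) a i *:
       \sum_(t < L n) r n t *: e (m (psi i) + S n + t)%N| <=
    `|\sum_(i < K) a i *: z (psi i)|.
  move=> psii npsi.
  (* Since [n <= psi i], every block [z (psi i)] contains a copy of [u_n]. *)
  have npsii i : (S n.+1 <= S (psi i).+1)%N.
    apply: (strictly_increasing_mono Si); rewrite ltnS (leq_trans npsi)//.
    exact: (strictly_increasing_mono psii).
  pose p i := m (psi i); have pi : strictly_increasing p.
    by move=> i j ij; apply: mi; exact: psii.
  have pS i : (S (psi i).+1 <= p i.+1 - p i)%N.
    rewrite leq_subRL ?(ltnW (pi _ _ _))// -mS.
    by apply: (strictly_increasing_mono mi); exact: psii.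
  (* [[p i, p i.+1)] also covers the blocks skipped by [psi], where [f] is zero; [g] keeps only the
     copy of [u_n]. *)
  pose f i t := if (t < S (psi i).+1)%N then a i * d t else 0.
  pose g i t := if (S n <= t < S n + L n)%N then a i * d t else 0.
  have gf i t : g i t = f i t \/ g i t = 0.
    rewrite /g /f; case: ifPn => [/andP[_ tL]|]; [left|by right].
    by rewrite (leq_trans tL)// -SS.
  have := suppression_chunks K unc pi gf.
  set lhs := (X in X <= _); set rhs := (X in _ <= X).
  have -> : rhs = `|\sum_(i < K) a i *: z (psi i)|.
    congr `|_|; apply: eq_bigr => i _.
    rewrite /f /z scaler_sumr.
    rewrite -(sum_trunc (fun t => a i *: (d t *: e (m (psi i) + t)%N)) (pS i)).
    by apply: eq_bigr => t _; case: ifP; rewrite ?scale0r ?scalerA.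
  suff -> : lhs = 2^-1 ^+ n * `|\sum_(i < K) a i *:
       \sum_(t < L n) r n t *: e (m (psi i) + S n + t)%N| by [].
  rewrite -[X in X * _]ger0_norm ?exprn_ge0 ?invr_ge0// -normrZ scaler_sumr.
  congr `|_|; apply: eq_bigr => i _.
  have sl : (S n + L n <= p i.+1 - p i)%N.
    by rewrite -SS; exact: leq_trans (npsii i) (pS i).
  under eq_bigr => t _ do rewrite /g (fun_if (fun w => w *: e (p i + t)%N)) scale0r.
  rewrite (sum_window (fun t => (a i * d t) *: e (p i + t)%N) sl).
  rewrite !scaler_sumr; apply: eq_bigr => t _.
  rewrite dE; last by rewrite SS ltn_add2l.
  by rewrite addnA !scalerA mulrCA mulrA.
have zle j : `|z j| <= 4.
  rewrite /z (sum_chunks (fun t => d t *: e (m j + t)%N) _ Si) S0 big_ord0 add0r.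
  apply: (@le_trans _ _ (\sum_(n < j.+1) 2^-1 ^+ n * 2)).
    apply: (le_trans (ler_norm_sum _ _ _)); apply: ler_sum => n _.
    rewrite SS addKn; have /andP[_] := rbd n (m j + S n)%N.
    move=> /(ler_wpM2l (exprn_ge0 n (ltW (_ : 0 < 2^-1 :> R)))).
    rewrite invr_gt0 ltr0n => /(_ isT).
    apply: le_trans; rewrite -[X in _ <= X * _]ger0_norm ?exprn_ge0 ?invr_ge0//.
    rewrite -normrZ scaler_sumr le_eqVlt; apply/orP; left; apply/eqP.
    congr `|_|; apply: eq_bigr => t _.
    by rewrite dE ?SS ?ltn_add2l// scalerA addnA.
  have -> : \sum_(n < j.+1) 2^-1 ^+ n * 2 = 4 - 4 * 2^-1 ^+ j.+1 :> R.
    elim: j.+1 => [|k IH]; first by rewrite big_ord0 expr0; ring.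
    by rewrite big_ord_recr /= IH exprS; field.
  by rewrite gerBl mulr_ge0// exprn_ge0// invr_ge0.
(* Suppressing all but the copy of [u_0], of weight 1, leaves norm at least 1/2. *)
have zgt j : 0 < `|z j|.
  have sh : strictly_increasing (addn j) by move=> i k; rewrite ltn_add2l.
  have := piece 0%N 1%N (addn j) (fun=> 1) sh (leq0n _).
  rewrite expr0 mul1r !big_ord1 !scale1r addn0; apply: lt_le_trans.
  have /andP[h _] := rbd 0%N (m j + S 0)%N.
  by apply: lt_le_trans h; rewrite invr_gt0.
exists (fun j => `|z j|^-1 *: z j); split.
  split; first by move=> j; rewrite normrZ normfV normr_id mulVf// gt_eqF.
  have [c [_ cE]] := glue (fun j t => `|z j|^-1 * d t) mi.
  exists m, c; split => // j.
  rewrite -{1}[m j]add0n big_addn big_mkord mS addKn scaler_sumr.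
  apply: eq_bigr => t _; rewrite [(t + _)%N]addnC cE ?scalerA//.
  by rewrite mS ltn_add2l.
move=> n K psi a psii npsi.
(* [q i] is the position of the copy of [u_n] in the block [psi i]; [a'] absorbs the
   normalization. *)
exists (fun i => m (psi i) + S n)%N, (fun i => a i * `|z (psi i)|^-1); split.
- move=> i; rewrite -addnA -SS.
  apply: (@leq_trans (m (psi i.+1))); last exact: leq_addr.
  apply: (@leq_trans (m (psi i).+1)).
    rewrite mS leq_add2l; apply: (strictly_increasing_mono Si).
    by rewrite ltnS (leq_trans npsi)//; exact: (strictly_increasing_mono psii).
  by apply: (strictly_increasing_mono mi); exact: psii.
- move=> i; rewrite normrM normfV normr_id mulrCA ler_peMr//.
  by rewrite ler_pdivlMr ?mul1r.
- pose a' i := a i * `|z (psi i)|^-1.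
  apply: (le_trans (piece n K psi a' psii npsi)).
  by under eq_bigr => i _ do rewrite -scalerA.
Qed.

End Blocks.


(** * Rosenthal's property against the failure of a lower [ell_1] estimate *)

Theorem corollary5 (R : realType) (X : completeNormedModType R)
    (e : nat -> X)
    (e_basic : basic_sequence e)
    (e_normalized : normalized e)
    (e_unconditional : suppression_unconditional e)
    (e_spreading : spreading_invariant e)
    (e_rosenthal : rosenthal e)
    (one_krivine : krivine_set e 1%E) :
  equivalent (lincomb_norm e) (lp_norm 1%E).
Proof.
apply: contrapT => not_l1.
have upper K a : lincomb_norm e K a <= \sum_(i < K) `|a i|.
  apply: (le_trans (ler_norm_sum _ _ _)); apply: ler_sum => i _.
  by rewrite normrZ e_normalized mulr1.
have bad n : {Ka : nat * (nat -> R) |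
    4 ^+ n * lincomb_norm e Ka.1 Ka.2 < \sum_(i < Ka.1) `|Ka.2 i|}.
  (* Without such a combination, [4 ^+ n] would be an equivalence constant, the other inequality
     being [upper]. *)
  apply: cid; apply: contrapT => nbad; apply: not_l1.
  have n4 : 1 <= 4 ^+ n :> R by rewrite exprn_ege1// ler1n.
  exists (4 ^+ n); split=> [|K a]; first exact: exprn_gt0.
  rewrite lp_norm1; split.
    apply: le_trans (upper K a); rewrite ler_piMl ?normr_ge0//.
    by rewrite invf_le1// exprn_gt0.
  by rewrite leNgt; apply/negP => h; apply: nbad; exists (K, a).
pose K n := (sval (bad n)).1; pose a n := (sval (bad n)).2.
have aP n : 4 ^+ n * lincomb_norm e (K n) (a n) < \sum_(i < K n) `|a n i|.
  exact: (svalP (bad n)).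
have K0 n : (0 < K n)%N.
  rewrite lt0n; apply/eqP => k0; have := aP n.
  by rewrite k0 big_ord0 /lincomb_norm /lincomb big_ord0 normr0 mulr0 ltxx.
have copies n : {Lr : nat * (nat -> R) | [/\ (0 < Lr.1)%N,
    forall p, 2^-1 <= `|\sum_(t < Lr.1) Lr.2 t *: e (p + t)%N| <= 2 &
    forall (q : nat -> nat) (a : nat -> R),
      (forall i, (i.+1 < K n)%N -> (q i + Lr.1 <= q i.+1)%N) ->
      \sum_(i < K n) `|a i| <=
      2 * `|\sum_(i < K n) a i *: \sum_(t < Lr.1) Lr.2 t *: e (q i + t)%N|]}.
  apply: cid; have [L [r h]] := krivine_copies e_spreading one_krivine (K0 n).
  by exists (L, r).
have [b [bb bP]] := @weighted_blocks _ _ e (fun n => (sval (copies n)).1)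
  (fun n => (sval (copies n)).2) e_unconditional
  (fun n => let: And3 h _ _ := svalP (copies n) in h)
  (fun n => let: And3 _ h _ := svalP (copies n) in h).
have [phi [phii [C [C0 Ceq]]]] := e_rosenthal b bb.
(* In [8 * C], 8 is the product of the 2 from [krivine_copies] and the 4 from the normalization. *)
pose n := (Num.truncn (8 * C)).+1.
have nC : 8 * C < 2 ^+ n.
  have : 8 * C < n%:R by exact: truncnS_gt.
  by move=> /lt_trans; apply; rewrite -natrX ltr_nat ltn_expl.
have psii : strictly_increasing (fun i => phi (n + i)%N).
  by move=> i j ij; apply: phii; rewrite ltn_add2l.
have npsi : (n <= phi (n + 0)%N)%N by rewrite addn0; exact: strictly_increasing_ge.
have [q [a' [qL aa' bge]]] := bP n (K n) _ (a n) psii npsi.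
have [_ _ /(_ q a' (fun i _ => qL i)) l1] := svalP (copies n).
(* The [n] leading zeros make the coefficients act on the terms [phi (n + i)], which are at least
   [n]; on the side of [e] the shift leaves the norm unchanged. *)
have [cb _] := Ceq (n + K n)%N (fun i => if (i < n)%N then 0 else a n (i - n)%N).
have shift (y : nat -> X) : lincomb_norm y (n + K n)
    (fun i => if (i < n)%N then 0 else a n (i - n)%N) =
    `|\sum_(i < K n) a n i *: y (n + i)%N|.
  rewrite /lincomb_norm /lincomb big_split_ord /= big1 ?add0r => [|i _]; last first.
    by rewrite ltn_ord scale0r.
  congr `|_|; apply: eq_bigr => i _.
  by rewrite ltnNge leq_addr addKn.
move: cb; rewrite !shift (norm_shift n (K n) (a n) e_spreading).
rewrite ler_pdivrMl// => /(le_trans bge) {}bge.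
have {}aa' : \sum_(i < K n) `|a n i| <= 4 * \sum_(i < K n) `|a' i|.
  by rewrite mulr_sumr; apply: ler_sum => i _; exact: aa'.
have aT := aP n; set T := lincomb_norm e _ _ in bge aT.
have T0 : 0 <= T by exact: normr_ge0.
set N := `|_| in bge l1.
have {bge} : N <= 2 ^+ n * (C * T).
  by move: bge; rewrite exprVn ler_pdivrMl// exprn_gt0.
have E4 : 4 ^+ n = 2 ^+ n * 2 ^+ n :> R by rewrite -exprMn; congr (_ ^+ n); ring.
rewrite E4 in aT.
move=> NT; have p2 : 0 < 2 ^+ n :> R by exact: exprn_gt0.
(* With [A] and [A'] the sums of [|a n i|] and [|a' i|], the contradiction is [4 ^+ n * T < A <= 4 *
   A' <= 8 * N <= 2 ^+ n * (8 * C) * T <= 4 ^+ n * T]. *)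
have : 2 ^+ n * (8 * C) * T <= 2 ^+ n * 2 ^+ n * T.
  by rewrite ler_wpM2r// ler_pM2l// ltW.
lra.
Qed.
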